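(* Let $\mathcal{A}$ and $\mathcal{B}$ be balanced categories with epimorphic images, and let $T:\mathcal{B}\to\mathcal{A}$ be left adjoint to $H:\mathcal{A}\to\mathcal{B}$ with counit $\delta:T\circ H\to\mathbf{1}_{\mathcal{A}}$ and unit $\eta:\mathbf{1}_{\mathcal{B}}\to H\circ T$. The following are equivalent: (i) The pair of adjoint functors $T\dashv H$ induces mutually inverse equivalences $\mathcal{G}_H\rightleftarrows\mathcal{G}^T$. (ii) $\delta_X:(T\circ H)(X)\to X$ is a monomorphism for all $X\in\mathcal{A}$ and $\eta_Y:Y\to(H\circ T)(Y)$ is an epimorphism for all $Y\in\mathcal{B}$.
   Context: All subcategories are full and closed under isomorphisms. A category is balanced if every morphism that is both a monomorphism and an epimorphism is an isomorphism. A category has epimorphic images if every morphism has an image (a smallest subobject of its codomain through which it factors) and the factorization of each morphism through its image is an epimorphism followed by a monomorphism. $\mathcal{G}_H=\{X\in\mathcal{A}\mid \delta_X:(T\circ H)(X)\to X\text{ is an epimorphism}\}$ and $\mathcal{G}^T=\{Y\in\mathcal{B}\mid \eta_Y:Y\to(H\circ T)(Y)\text{ is a monomorphism}\}$. ''$T\dashv H$ induces mutually inverse equivalences $\mathcal{X}\rightleftarrows\mathcal{Y}$'' (for $\mathcal{X}\subseteq\mathcal{A}$, $\mathcal{Y}\subseteq\mathcal{B}$) means that $H$ restricts to a functor $\mathcal{X}\to\mathcal{Y}$, $T$ restricts to a functor $\mathcal{Y}\to\mathcal{X}$, and these restrictions are mutually quasi-inverse equivalences. *)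

(* Defs.v *)
Set Implicit Arguments.
Unset Strict Implicit.
Unset Printing Implicit Defensive.

Declare Scope cat_scope.
Delimit Scope cat_scope with cat.
Open Scope cat_scope.

Record category := Category {
  obj :> Type;
  hom : obj -> obj -> Type;
  idm : forall X, hom X X;
  comp : forall X Y Z, hom Y Z -> hom X Y -> hom X Z;
  comp_idl : forall X Y (f : hom X Y), comp (idm Y) f = f;
  comp_idr : forall X Y (f : hom X Y), comp f (idm X) = f;
  comp_assoc : forall X Y Z W (h : hom Z W) (g : hom Y Z) (f : hom X Y),
    comp h (comp g f) = comp (comp h g) f }.

Arguments idm {c} X.
Notation "g ∘ f" := (comp g f) (at level 40, left associativity) : cat_scope.

Section Morphisms.
Variable C : category.

Definition mono (X Y : C) (f : hom X Y) : Prop :=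
  forall (Z : C) (g h : hom Z X), f ∘ g = f ∘ h -> g = h.

Definition epi (X Y : C) (f : hom X Y) : Prop :=
  forall (Z : C) (g h : hom Y Z), g ∘ f = h ∘ f -> g = h.

Definition iso (X Y : C) (f : hom X Y) : Prop :=
  exists g : hom Y X, g ∘ f = idm X /\ f ∘ g = idm Y.

Definition balanced : Prop :=
  forall (X Y : C) (f : hom X Y), mono f -> epi f -> iso f.

Definition factors_through (X I Y : C) (f : hom X Y) (m : hom I Y) : Prop :=
  exists e : hom X I, f = m ∘ e.

(* Subobjects of [Y] are represented by monomorphisms into [Y]; for such
   [m] and [n], [factors_through m n] is the inclusion order. *)
Record is_image (X Y : C) (f : hom X Y) (I : C) (m : hom I Y) : Prop := {
  image_mono : mono m;
  image_factors : factors_through f m;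
  image_smallest : forall (J : C) (n : hom J Y),
    mono n -> factors_through f n -> factors_through m n }.

Definition has_epimorphic_images : Prop :=
  forall (X Y : C) (f : hom X Y),
    (exists (I : C) (m : hom I Y), is_image f m) /\
    (forall (I : C) (m : hom I Y) (e : hom X I),
       is_image f m -> f = m ∘ e -> epi e).

End Morphisms.

Arguments balanced : clear implicits.
Arguments has_epimorphic_images : clear implicits.

Record functor (C D : category) := Functor {
  fobj :> C -> D;
  fmap : forall X Y : C, hom X Y -> hom (fobj X) (fobj Y);
  fmap_id : forall X : C, fmap (idm X) = idm (fobj X);
  fmap_comp : forall (X Y Z : C) (g : hom Y Z) (f : hom X Y),
    fmap (g ∘ f) = fmap g ∘ fmap f }.

Definition functor_id (C : category) : functor C C :=
  @Functor C C (fun X => X) (fun _ _ f => f)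
    (fun _ => eq_refl) (fun _ _ _ _ _ => eq_refl).

Definition functor_comp (C D E : category) (G : functor D E) (F : functor C D) :
  functor C E.
Proof.
refine (@Functor C E (fun X => G (F X)) (fun _ _ f => fmap G (fmap F f)) _ _).
- intros X; rewrite fmap_id; apply fmap_id.
- intros X Y Z g f; rewrite fmap_comp; apply fmap_comp.
Defined.

Record nattrans (C D : category) (F G : functor C D) := NatTrans {
  component :> forall X : C, hom (F X) (G X);
  naturality : forall (X Y : C) (f : hom X Y),
    component Y ∘ fmap F f = fmap G f ∘ component X }.

Definition naturally_isomorphic (C D : category) (F G : functor C D) : Prop :=
  exists a : nattrans F G, forall X : C, iso (a X).

Definition quasi_inverse (C D : category) (F : functor C D) (G : functor D C) :
  Prop :=
  naturally_isomorphic (functor_comp G F) (functor_id C) /\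
  naturally_isomorphic (functor_comp F G) (functor_id D).

(* [T] is left adjoint to [H]. *)
Record adjunction (A B : category) (T : functor B A) (H : functor A B) :=
  Adjunction {
  adj_counit : nattrans (functor_comp T H) (functor_id A);
  adj_unit : nattrans (functor_id B) (functor_comp H T);
  triangle_left : forall Y : B, adj_counit (T Y) ∘ fmap T (adj_unit Y) = idm (T Y);
  triangle_right : forall X : A, fmap H (adj_counit X) ∘ adj_unit (H X) = idm (H X) }.

Definition full_subcategory (C : category) (P : C -> Prop) : category :=
  @Category {X : C | P X}
    (fun X Y => hom (proj1_sig X) (proj1_sig Y))
    (fun X => idm (proj1_sig X))
    (fun X Y Z g f => g ∘ f)
    (fun X Y f => comp_idl f)
    (fun X Y f => comp_idr f)
    (fun X Y Z W h g f => comp_assoc h g f).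

Definition restrict (C D : category) (P : C -> Prop) (Q : D -> Prop)
    (F : functor C D) (FPQ : forall X : C, P X -> Q (F X)) :
  functor (full_subcategory P) (full_subcategory Q) :=
  @Functor (full_subcategory P) (full_subcategory Q)
    (fun X => exist Q (F (proj1_sig X)) (FPQ _ (proj2_sig X)))
    (fun X Y f => fmap F f)
    (fun X => fmap_id F (proj1_sig X))
    (fun X Y Z g f => fmap_comp F g f).

Definition induces_inverse_equivalences (A B : category)
    (T : functor B A) (H : functor A B) (P : A -> Prop) (Q : B -> Prop) : Prop :=
  exists (HPQ : forall X : A, P X -> Q (H X))
         (TQP : forall Y : B, Q Y -> P (T Y)),
    quasi_inverse (restrict HPQ) (restrict TQP).

Section Generated.
Variables (A B : category) (T : functor B A) (H : functor A B).
Variable adj : adjunction T H.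

(* The objects of $\mathcal{G}_H$ and of $\mathcal{G}^T$. *)
Definition G_sub (X : A) : Prop := epi (adj_counit adj X).
Definition G_sup (Y : B) : Prop := mono (adj_unit adj Y).

End Generated.

(* Main.v *)
(** The adjunction restricts to [G_sub] and [G_sup]; when it is there an
    equivalence, fullness and faithfulness force the counit (unit) to be
    invertible on these subcategories.  For arbitrary [X], let [m ∘ e] be the
    epi-mono factorization of [δ X].  The domain [I] of [m] lies in [G_sub], so
    [δ I] is invertible, and so is [H m], being a split epimorphism and a
    monomorphism; by naturality [δ X] is [m] up to isomorphisms.  The unit is
    treated by passing to opposite categories.  Conversely, every [H X] lies
    in [G_sup] and every [T Y] in [G_sub] by the triangle identities, and
    balancedness makes the counit and unit invertible there. *)

Require Import Defs.
From Stdlib Require Import IndefiniteDescription.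

Set Implicit Arguments.
Unset Strict Implicit.

(** * Monomorphisms, epimorphisms and factorizations *)

Section Morphisms.
Variable C : category.

Lemma iso_epi (X Y : C) (f : hom X Y) : iso f -> epi f.
Proof.
intros [g [_ fg]] Z u v E.
rewrite <- (comp_idr u), <- (comp_idr v), <- fg, !comp_assoc, E; reflexivity.
Qed.

Lemma iso_mono (X Y : C) (f : hom X Y) : iso f -> mono f.
Proof.
intros [g [gf _]] Z u v E.
rewrite <- (comp_idl u), <- (comp_idl v), <- gf, <- !comp_assoc, E; reflexivity.
Qed.

Lemma mono_comp (X Y Z : C) (g : hom Y Z) (f : hom X Y) :
  mono g -> mono f -> mono (g ∘ f).
Proof.
intros Mg Mf W u v E; apply Mf, Mg; rewrite !comp_assoc; exact E.
Qed.

Lemma split_mono (X Y : C) (f : hom X Y) (g : hom Y X) :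
  g ∘ f = idm X -> mono f.
Proof.
intros gf Z u v E.
rewrite <- (comp_idl u), <- (comp_idl v), <- gf, <- !comp_assoc, E; reflexivity.
Qed.

Lemma split_epi (X Y : C) (f : hom X Y) (g : hom Y X) :
  f ∘ g = idm Y -> epi f.
Proof.
intros fg Z u v E.
rewrite <- (comp_idr u), <- (comp_idr v), <- fg, !comp_assoc, E; reflexivity.
Qed.

Lemma epi_of_comp (X Y Z : C) (g : hom Y Z) (f : hom X Y) :
  epi (g ∘ f) -> epi g.
Proof.
intros E W u v uv; apply E; rewrite !comp_assoc, uv; reflexivity.
Qed.

Lemma mono_split_epi_inverse (X Y : C) (f : hom X Y) (g : hom Y X) :
  mono f -> f ∘ g = idm Y -> g ∘ f = idm X.
Proof.
intros Mf fg; apply Mf; rewrite comp_assoc, fg, comp_idl, comp_idr; reflexivity.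
Qed.

(** Unlike the existence of smallest subobjects, this consequence is visibly self-dual, so it passes
    to opposite categories. *)
Definition has_epi_mono_factorizations : Prop :=
  forall (X Y : C) (f : hom X Y),
    exists (I : C) (m : hom I Y) (e : hom X I), mono m /\ epi e /\ f = m ∘ e.

Lemma epimorphic_images_factorizations :
  has_epimorphic_images C -> has_epi_mono_factorizations.
Proof.
intros im X Y f; destruct (im X Y f) as [[I [m Im]] Ie].
destruct (image_factors Im) as [e fe].
exists I, m, e; repeat split; [exact (image_mono Im) | | exact fe].
exact (Ie I m e Im fe).
Qed.

End Morphisms.

Arguments has_epi_mono_factorizations : clear implicits.

(** * Full and faithful functors *)

Definition faithful (C D : category) (F : functor C D) : Prop :=
  forall (X Y : C) (f g : hom X Y), fmap F f = fmap F g -> f = g.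

Definition full (C D : category) (F : functor C D) : Prop :=
  forall (X Y : C) (h : hom (F X) (F Y)), exists f : hom X Y, fmap F f = h.

Lemma faithful_of_retraction (C D : category) (F : functor C D)
    (G : functor D C) :
  naturally_isomorphic (functor_comp G F) (functor_id C) -> faithful F.
Proof.
intros [a Ia] X Y f g E; apply (iso_epi (Ia X)).
pose proof (naturality a f) as Nf; pose proof (naturality a g) as Ng.
cbn in Nf, Ng |- *; rewrite <- Nf, <- Ng, E; reflexivity.
Qed.

Lemma full_of_quasi_inverse (C D : category) (F : functor C D)
    (G : functor D C) :
  quasi_inverse F G -> full F.
Proof.
intros [[a Ia] GF] X Y h; destruct (Ia X) as [b [ba _]].
(* The preimage is [fmap G h] conjugated by [a]. Its image under [F] is compared with [h] after
   applying [G], which is faithful by [GF]. *)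
exists (a Y ∘ fmap G h ∘ b); apply (faithful_of_retraction GF), (iso_mono (Ia Y)).
etransitivity; [exact (naturality a (a Y ∘ fmap G h ∘ b)) |].
cbn in *; rewrite <- comp_assoc, ba, comp_idr; reflexivity.
Qed.

(* [adj_counit] and [adj_unit] with [functor_comp] and [functor_id] unfolded in
   their types, so that rewriting matches syntactically. *)
Definition counit (A B : category) (T : functor B A) (H : functor A B)
    (adj : adjunction T H) (X : A) : hom (T (H X)) X := adj_counit adj X.

Definition unit (A B : category) (T : functor B A) (H : functor A B)
    (adj : adjunction T H) (Y : B) : hom Y (H (T Y)) := adj_unit adj Y.

(** * The counit of an adjunction *)

Section Adjunction.
Variables (A B : category) (T : functor B A) (H : functor A B).
Variable adj : adjunction T H.

Local Notation δ := (counit adj).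
Local Notation η := (unit adj).

Lemma triangle_counit_T (Y : B) : δ (T Y) ∘ fmap T (η Y) = idm (T Y).
Proof. exact (triangle_left adj Y). Qed.

Lemma triangle_H_counit (X : A) : fmap H (δ X) ∘ η (H X) = idm (H X).
Proof. exact (triangle_right adj X). Qed.

Lemma counit_natural (X Y : A) (f : hom X Y) :
  δ Y ∘ fmap T (fmap H f) = f ∘ δ X.
Proof. exact (naturality (adj_counit adj) f). Qed.

Lemma unit_natural (X Y : B) (f : hom X Y) :
  η Y ∘ f = fmap H (fmap T f) ∘ η X.
Proof. exact (naturality (adj_unit adj) f). Qed.

Lemma counit_transpose (Y : B) (X : A) (f : hom (T Y) X) :
  δ X ∘ fmap T (fmap H f ∘ η Y) = f.
Proof.
rewrite fmap_comp, comp_assoc, counit_natural, <- comp_assoc, triangle_counit_T.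
apply comp_idr.
Qed.

Lemma unit_transpose (Y : B) (X : A) (g : hom Y (H X)) :
  fmap H (δ X ∘ fmap T g) ∘ η Y = g.
Proof.
rewrite fmap_comp, <- comp_assoc, <- unit_natural, comp_assoc, triangle_H_counit.
apply comp_idl.
Qed.

Lemma right_adjoint_mono (X Y : A) (f : hom X Y) : mono f -> mono (fmap H f).
Proof.
intros Mf Z u v E; rewrite <- (unit_transpose u), <- (unit_transpose v).
do 2 f_equal; apply Mf.
rewrite !comp_assoc, <- !counit_natural, <- !comp_assoc, <- !fmap_comp, E.
reflexivity.
Qed.

(** Fullness lifts [η (H X)] to a morphism [s], the inverse of [δ X]: one composite is checked on
    transposes, the other after applying the faithful [H]. *)
Lemma counit_iso_of_full_faithful :
  full H -> faithful H -> forall X : A, iso (δ X).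
Proof.
intros HF Hf X; destruct (HF X (T (H X)) (η (H X))) as [s Es].
exists s; split.
- rewrite <- (counit_transpose (s ∘ δ X)), <- (counit_transpose (idm _)).
  do 2 f_equal.
  rewrite fmap_comp, Es, fmap_id, comp_idl, <- comp_assoc, triangle_H_counit.
  apply comp_idr.
- apply Hf; rewrite fmap_comp, Es, fmap_id; apply triangle_H_counit.
Qed.

Lemma counit_mono :
  has_epi_mono_factorizations A ->
  (forall X : A, epi (δ X) -> iso (δ X)) -> forall X : A, mono (δ X).
Proof.
intros fact Iδ X; destruct (fact _ _ (δ X)) as [I [m [e [Mm [Ee E]]]]].
assert (ID : iso (δ I)).
{ apply Iδ.
  (* The epimorphism [e] factors through [δ I] via its own transpose, called [s] below. *)
  apply (epi_of_comp (f := fmap T (fmap H e ∘ η (H X)))).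
  rewrite counit_transpose; exact Ee. }
set (s := fmap H e ∘ η (H X)).
assert (ms : fmap H m ∘ s = idm _).
{ unfold s; rewrite comp_assoc, <- fmap_comp, <- E; apply triangle_H_counit. }
pose proof (mono_split_epi_inverse (right_adjoint_mono Mm) ms) as sm.
(* Naturality of [δ] at [m], together with [ms], gives this factorization; its last factor has the
   retraction [fmap T (fmap H m)]. *)
replace (δ X) with (m ∘ δ I ∘ fmap T s).
- apply mono_comp; [apply mono_comp; [exact Mm | exact (iso_mono ID)] |].
  apply split_mono with (g := fmap T (fmap H m)).
  rewrite <- fmap_comp, ms; apply fmap_id.
- rewrite <- counit_natural, <- comp_assoc, <- fmap_comp, ms, fmap_id.
  apply comp_idr.
Qed.

(** Makes the fully faithful criterion applicable inside the subcategories, since [H] and [T] need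
    not be fully faithful globally. *)
Definition restrict_adjunction (P : A -> Prop) (Q : B -> Prop)
    (HPQ : forall X : A, P X -> Q (H X)) (TQP : forall Y : B, Q Y -> P (T Y)) :
  adjunction (restrict TQP) (restrict HPQ) :=
  @Adjunction _ _ (restrict TQP) (restrict HPQ)
    (@NatTrans _ _ (functor_comp (restrict TQP) (restrict HPQ)) (functor_id _)
       (fun X => adj_counit adj (proj1_sig X)) (fun X Y f => naturality (adj_counit adj) f))
    (@NatTrans _ _ (functor_id _) (functor_comp (restrict HPQ) (restrict TQP))
       (fun Y => adj_unit adj (proj1_sig Y)) (fun X Y f => naturality (adj_unit adj) f))
    (fun Y => triangle_left adj (proj1_sig Y))
    (fun X => triangle_right adj (proj1_sig X)).

End Adjunction.

(** * Duality and the unit *)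

Definition op (C : category) : category :=
  @Category C (fun X Y => @hom C Y X) (fun X => idm X)
    (fun X Y Z g f => @comp C Z Y X f g)
    (fun X Y f => comp_idr f) (fun X Y f => comp_idl f)
    (fun X Y Z W h g f => eq_sym (@comp_assoc C W Z Y X f g h)).

Definition op_functor (C D : category) (F : functor C D) :
  functor (op C) (op D) :=
  @Functor (op C) (op D) (fun X => F X) (fun X Y f => fmap F f)
    (fun X => fmap_id F X) (fun X Y Z g f => @fmap_comp C D F Z Y X f g).

(** The adjoints swap sides and the unit becomes the counit, so results on counits yield results on
    units. *)
Definition op_adjunction (A B : category) (T : functor B A) (H : functor A B)
    (adj : adjunction T H) : adjunction (op_functor H) (op_functor T) :=
  @Adjunction (op B) (op A) (op_functor H) (op_functor T)
    (@NatTrans _ _ (functor_comp (op_functor H) (op_functor T)) (functor_id _)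
       (fun Y => adj_unit adj Y)
       (fun X Y f => eq_sym (@naturality _ _ _ _ (adj_unit adj) Y X f)))
    (@NatTrans _ _ (functor_id _) (functor_comp (op_functor T) (op_functor H))
       (fun X => adj_counit adj X)
       (fun X Y f => eq_sym (@naturality _ _ _ _ (adj_counit adj) Y X f)))
    (fun X => triangle_right adj X) (fun Y => triangle_left adj Y).

Lemma op_iso (C : category) (X Y : C) (f : hom X Y) :
  @iso (op C) Y X f <-> iso f.
Proof. split; intros [g [gf fg]]; exists g; split; assumption. Qed.

Lemma op_factorizations (C : category) :
  has_epi_mono_factorizations C -> has_epi_mono_factorizations (op C).
Proof.
intros fact X Y f; destruct (fact Y X f) as [I [m [e [Mm [Ee E]]]]].
exists I, e, m; repeat split; [exact Ee | exact Mm | exact E].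
Qed.

Section DualAdjunction.
Variables (A B : category) (T : functor B A) (H : functor A B).
Variable adj : adjunction T H.

Lemma unit_iso_of_full_faithful :
  full T -> faithful T -> forall Y : B, iso (adj_unit adj Y).
Proof.
intros TF Tf Y; apply op_iso.
apply (counit_iso_of_full_faithful (op_adjunction adj)).
- intros X Z h; exact (TF Z X h).
- intros X Z f g; exact (Tf Z X f g).
Qed.

Lemma unit_epi :
  has_epi_mono_factorizations B ->
  (forall Y : B, mono (adj_unit adj Y) -> iso (adj_unit adj Y)) ->
  forall Y : B, epi (adj_unit adj Y).
Proof.
intros fact Iη Y.
(* A monomorphism of [op B] is, by conversion, an epimorphism of [B]. *)
apply (counit_mono (adj := op_adjunction adj) (op_factorizations fact)).
intros Z M; apply op_iso, Iη; exact M.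
Qed.

End DualAdjunction.

(** * Equivalences between full subcategories *)

Lemma full_subcategory_iso (C : category) (P : C -> Prop)
    (X Y : full_subcategory P) (f : hom X Y) :
  iso f <-> @iso C (proj1_sig X) (proj1_sig Y) f.
Proof. split; exact (fun I => I). Qed.

Lemma naturally_isomorphic_sym (C D : category) (F G : functor C D) :
  naturally_isomorphic F G -> naturally_isomorphic G F.
Proof.
intros [a Ia].
(* Inverses are only known to exist, whereas a natural transformation is data, so a family of them
   is chosen. *)
pose (b X := constructive_indefinite_description _ (Ia X)).
assert (N : forall (X Y : C) (f : hom X Y),
  proj1_sig (b Y) ∘ fmap G f = fmap F f ∘ proj1_sig (b X)).
{ intros X Y f; destruct (b X) as [bX [ba ab]], (b Y) as [bY [ba' ab']]; cbn.
  apply (iso_epi (Ia X)), (iso_mono (Ia Y)).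
  rewrite <- !comp_assoc, ba, comp_idr, <- naturality.
  rewrite (comp_assoc bY), ba', comp_idl; reflexivity. }
exists (NatTrans N); intros X; cbn; exists (a X).
destruct (b X) as [bX [ba ab]]; split; assumption.
Qed.

Section InducedEquivalence.
Variables (A B : category) (T : functor B A) (H : functor A B).
Variable adj : adjunction T H.

(** The natural isomorphisms of the equivalence need not be the counit and unit; they serve only to
    make the restricted functors full and faithful. *)
Lemma induced_equivalence_isos (P : A -> Prop) (Q : B -> Prop) :
  induces_inverse_equivalences T H P Q ->
  (forall X : A, P X -> iso (adj_counit adj X)) /\
  (forall Y : B, Q Y -> iso (adj_unit adj Y)).
Proof.
intros [HPQ [TQP [TH HT]]].
pose (radj := restrict_adjunction adj HPQ TQP); split.
- intros X PX; apply (full_subcategory_iso (P := P)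
    (X := exist P (T (H X)) (TQP _ (HPQ _ PX))) (Y := exist P X PX)).
  apply (counit_iso_of_full_faithful radj
    (full_of_quasi_inverse (conj TH HT)) (faithful_of_retraction TH)
    (exist P X PX)).
- intros Y QY; apply (full_subcategory_iso (P := Q)
    (X := exist Q Y QY) (Y := exist Q (H (T Y)) (HPQ _ (TQP _ QY)))).
  apply (unit_iso_of_full_faithful radj
    (full_of_quasi_inverse (conj HT TH)) (faithful_of_retraction HT)
    (exist Q Y QY)).
Qed.

Lemma induced_equivalence_of_isos (P : A -> Prop) (Q : B -> Prop)
    (HPQ : forall X : A, P X -> Q (H X)) (TQP : forall Y : B, Q Y -> P (T Y)) :
  (forall X : A, P X -> iso (adj_counit adj X)) ->
  (forall Y : B, Q Y -> iso (adj_unit adj Y)) ->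
  induces_inverse_equivalences T H P Q.
Proof.
intros Iδ Iη; pose (radj := restrict_adjunction adj HPQ TQP).
exists HPQ, TQP; split.
- exists (adj_counit radj); intros [X PX]; exact (Iδ X PX).
(* The unit points from the identity to the composite, against the direction in [quasi_inverse]. *)
- apply naturally_isomorphic_sym.
  exists (adj_unit radj); intros [Y QY]; exact (Iη Y QY).
Qed.

End InducedEquivalence.

Theorem theorem2p11 (A B : category)
    (balA : balanced A) (balB : balanced B)
    (imA : has_epimorphic_images A) (imB : has_epimorphic_images B)
    (T : functor B A) (H : functor A B) (adj : adjunction T H) :
  induces_inverse_equivalences T H (G_sub adj) (G_sup adj) <->
  (forall X : A, mono (adj_counit adj X)) /\ (forall Y : B, epi (adj_unit adj Y)).
Proof.
split.
- intros E; destruct (induced_equivalence_isos adj E) as [Iδ Iη]; split.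
  + exact (counit_mono (epimorphic_images_factorizations imA) Iδ).
  + exact (unit_epi (epimorphic_images_factorizations imB) Iη).
- intros [Mδ Eη]; apply induced_equivalence_of_isos with (adj := adj).
  + intros X _; exact (split_mono (triangle_right adj X)).
  + intros Y _; exact (split_epi (triangle_left adj Y)).
  + intros X EX; exact (balA _ _ _ (Mδ X) EX).
  + intros Y MY; exact (balB _ _ _ MY (Eη Y)).
Qed.
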